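(* If $R$ is an integral domain, then the ring of formal power series $R[[x]]$ is not hereditarily atomic.
   Context: An integral domain is atomic if every nonzero nonunit element factors into (finitely many) irreducible elements. An integral domain is hereditarily atomic if every one of its subrings (with the same identity) is atomic. *)

(* Defs.v *)
From HB Require Import structures.
From mathcomp Require Import all_boot all_order all_algebra.
From mathcomp Require Import boolp.

Set Implicit Arguments.
Unset Strict Implicit.
Unset Printing Implicit Defensive.

Import GRing.Theory.
Local Open Scope ring_scope.

(* A record rather than a synonym for [nat -> R], because functions into a ring
   already carry the pointwise product in MathComp-Analysis. *)
Record fps (R : Type) := FPS { fps_coef : nat -> R }.

HB.instance Definition _ (R : Type) := gen_eqMixin (fps R).
HB.instance Definition _ (R : Type) := gen_choiceMixin (fps R).

Lemma fpsP (R : Type) (f g : fps R) : fps_coef f =1 fps_coef g <-> f = g.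
Proof. by case: f g => [f] [g]; split=> [/= /funext -> | [->]]. Qed.

Section FpsZmodule.
Variable R : zmodType.
Implicit Types f g h : fps R.

Definition fps_zero : fps R := FPS (fun _ => 0).
Definition fps_opp f : fps R := FPS (fun n => - fps_coef f n).
Definition fps_add f g : fps R := FPS (fun n => fps_coef f n + fps_coef g n).

Fact fps_addA : associative fps_add.
Proof. by move=> f g h; apply/fpsP => n /=; rewrite addrA. Qed.
Fact fps_addC : commutative fps_add.
Proof. by move=> f g; apply/fpsP => n /=; rewrite addrC. Qed.
Fact fps_add0 : left_id fps_zero fps_add.
Proof. by move=> f; apply/fpsP => n /=; rewrite add0r. Qed.
Fact fps_addN : left_inverse fps_zero fps_opp fps_add.
Proof. by move=> f; apply/fpsP => n /=; rewrite addNr. Qed.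

HB.instance Definition _ :=
  GRing.isZmodule.Build (fps R) fps_addA fps_addC fps_add0 fps_addN.
End FpsZmodule.

Section FpsComRing.
Variable R : comNzRingType.
Implicit Types f g h : fps R.

Definition fps_one : fps R := FPS (fun n => (n == 0)%:R).
Definition fps_mul f g : fps R :=
  FPS (fun n => \sum_(i < n.+1) fps_coef f i * fps_coef g (n - i)).

Definition fps_trunc m f : {poly R} := \poly_(i < m) fps_coef f i.

Fact coef_fps_mul_trunc m f g n : (n < m)%N ->
  fps_coef (fps_mul f g) n = (fps_trunc m f * fps_trunc m g)`_n.
Proof.
move=> lt_nm; rewrite coefM; apply: eq_bigr => i _; rewrite !coef_poly.
have le_in : (i <= n)%N by rewrite -ltnS.
by rewrite (leq_ltn_trans le_in) // (leq_ltn_trans (leq_subr i n)).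
Qed.

Fact fps_mulC : commutative fps_mul.
Proof.
by move=> f g; apply/fpsP => n; rewrite !(@coef_fps_mul_trunc n.+1) // mulrC.
Qed.

Fact fps_mulA : associative fps_mul.
Proof.
move=> f g h; apply/fpsP => n; pose t := fps_trunc n.+1.
transitivity ((t f * (t g * t h))`_n).
  rewrite coefM; apply: eq_bigr => i _.
  by rewrite coef_poly ltn_ord (@coef_fps_mul_trunc n.+1) // ltnS leq_subr.
rewrite mulrA coefM; apply: eq_bigr => i _.
by rewrite [in RHS](@coef_fps_mul_trunc n.+1) // coef_poly ltnS leq_subr.
Qed.

Fact fps_mul1 : left_id fps_one fps_mul.
Proof.
move=> f; apply/fpsP => n; rewrite /= big_ord_recl /= mul1r subn0.
by rewrite big1 ?addr0 // => i _; rewrite mul0r.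
Qed.

Fact fps_mulDl : left_distributive fps_mul (@fps_add R).
Proof.
move=> f g h; apply/fpsP => n /=; rewrite -big_split /=.
by apply: eq_bigr => i _; rewrite mulrDl.
Qed.

Fact fps_one_neq0 : fps_one != fps_zero R.
Proof. by apply/eqP => /fpsP/(_ 0)/eqP; rewrite /= oner_eq0. Qed.

HB.instance Definition _ := GRing.Zmodule_isComNzRing.Build (fps R)
  fps_mulA fps_mulC fps_mul1 fps_mulDl fps_one_neq0.
End FpsComRing.

(* MathComp bundles a boolean unit predicate and an inverse with every
   idomainType; on an arbitrary commutative ring they exist classically. *)
Section ClassicalUnits.
Variable R : comNzRingType.

Definition cl_unit : {pred R} := fun f => `[< exists g, g * f = 1 >].
Definition cl_inv (f : R) : R :=
  if pselect (exists g, g * f = 1) is left fU then projT1 (cid fU) else f.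

Fact cl_mulVx : {in cl_unit, left_inverse 1 cl_inv *%R}.
Proof.
move=> f /asboolP fU; rewrite /cl_inv; case: pselect => // fU'.
by case: (cid fU').
Qed.
Fact cl_unitPl (f g : R) : g * f = 1 -> cl_unit f.
Proof. by move=> gf1; apply/asboolP; exists g. Qed.
Fact cl_inv_out : {in [predC cl_unit], cl_inv =1 id}.
Proof.
by move=> f /asboolPn fNU; rewrite /cl_inv; case: pselect.
Qed.
End ClassicalUnits.

Section FpsIdomain.
Variable R : idomainType.

HB.instance Definition _ := GRing.ComNzRing_hasMulInverse.Build (fps R)
  (@cl_mulVx _) (@cl_unitPl _) (@cl_inv_out _).

Fact fps_order (f : fps R) : f != 0 ->
  exists2 m, fps_coef f m != 0 & forall i, (i < m)%N -> fps_coef f i = 0.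
Proof.
move=> f0; have /ex_minnP[m fm minm] : exists m, fps_coef f m != 0.
  apply: contrapT => nex; case/eqP: f0; apply/fpsP => n /=.
  by apply: contrapT => /eqP fn; apply: nex; exists n.
exists m => // i lt_im; apply: contrapT => /eqP/minm.
by rewrite leqNgt lt_im.
Qed.

Fact fps_mul_eq0 : GRing.integral_domain_axiom (fps R).
Proof.
move=> f g fg0; apply: contrapT => /negP; rewrite negb_or => /andP[f0 g0].
have [m fm f_lt] := fps_order f0; have [n gn g_lt] := fps_order g0.
move/fpsP/(_ (m + n)%N): fg0; apply/eqP.
rewrite /= (bigD1 (inord m)) //= inordK ?ltnS ?leq_addr // addKn big1.
  by rewrite addr0 mulf_neq0.
move=> i; rewrite -val_eqE /= inordK ?ltnS ?leq_addr // neq_ltn.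
case/orP => [/f_lt -> | lt_mi]; first by rewrite mul0r.
by rewrite g_lt ?mulr0 // ltn_subLR ?ltn_add2r // -ltnS.
Qed.

HB.instance Definition _ :=
  GRing.ComUnitRing_isIntegral.Build (fps R) fps_mul_eq0.
End FpsIdomain.

Section Atomicity.
Variable D : idomainType.

Definition irreducible_elt (a : D) : Prop :=
  [/\ a != 0, a \isn't a GRing.unit &
      forall b c, a = b * c -> b \is a GRing.unit \/ c \is a GRing.unit].

Definition atomic : Prop :=
  forall a : D, a != 0 -> a \isn't a GRing.unit ->
    exists2 s : seq D, {in s, forall b, irreducible_elt b} & a = \prod_(b <- s) b.

End Atomicity.

(* subIdomainType S is a type of the elements of S with ring operations for which
   val is a ring morphism, hence 1 is that of D, but val need not reflect units:
   atomic U refers to the units of the subring, not to those of D. *)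
Definition hereditarily_atomic (D : idomainType) : Prop :=
  forall (S : {pred D}) (U : subIdomainType S), atomic U.

(* Every subring of D is among those over which hereditarily_atomic ranges. *)
Section SubringDomain.
Variables (D : idomainType) (S : {pred D}).

(* The closure proof is a parameter of the type, so that the ring instances below
   can be inferred from it. *)
Definition subring_dom of subring_closed S := {x : D | x \in S}.

Variable subringS : subring_closed S.
Local Notation Sdom := (subring_dom subringS).

HB.instance Definition _ := SubChoice.on Sdom.
HB.instance Definition _ :=
  GRing.SubChoice_isSubComNzRing.Build D S Sdom subringS.
HB.instance Definition _ := GRing.ComNzRing_hasMulInverse.Build Sdom
  (@cl_mulVx _) (@cl_unitPl _) (@cl_inv_out _).

Fact subring_dom_mul_eq0 : GRing.integral_domain_axiom Sdom.
Proof.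
move=> a b /(congr1 val)/eqP; rewrite rmorphM rmorph0 mulf_eq0 /=.
by rewrite -!(inj_eq val_inj) rmorph0.
Qed.

HB.instance Definition _ :=
  GRing.ComUnitRing_isIntegral.Build Sdom subring_dom_mul_eq0.

Fact subring_subIdomain : inhabited (subIdomainType S).
Proof. by constructor; exact: (GRing.SubIntegralDomain.clone D S Sdom _). Qed.
End SubringDomain.

(* Main.v *)
Require Import Defs.
From HB Require Import structures.
From mathcomp Require Import all_boot all_order all_algebra.
From mathcomp Require Import boolp.
From mathcomp Require Import zify.

(** A ring can fail to be atomic when one of its nonunits u divides y
infinitely often.  Suppose that a domain D contains a polynomial ring A[Y], and
that some nonunit u of A becomes a unit in D.  Then D contains the subring
S = A + Y A[u^-1][Y] = { f in A[u^-1][Y] | f(0) in A }, in which u is still a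
nonunit: an inverse of u in S would have its value at Y = 0 in A.  The elements
with value 0 at Y = 0 form a nonzero prime ideal I of S, and each element of I
is u times another element of I.  So I contains no irreducible element; but if
Y were a product of irreducibles, primality would put one of them in I.  Hence
D is not hereditarily atomic ([poly_subring_not_hereditarily_atomic]).

The ring of power series over R fits this with A = R[x] and u = 1 - x, which the
geometric series inverts.  What remains is a power series y transcendental
over R[x], to play the role of Y.  The lacunary series y = sum_n x^(n!), summed
over distinct exponents, will do ([fact_series_transcendental]).  If P(y) = 0
with P in R[x][Y] and s is the part of y of degree at most N!, then P(s) is
congruent to P(y) = 0 modulo x^((N+1)!), while the degree of P(s) grows only
like a constant multiple of N!.  So P(s) = 0 for every large N, and a nonzero P
would have infinitely many roots in the domain R[x]. *)

Set Implicit Arguments.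
Unset Strict Implicit.
Unset Printing Implicit Defensive.

Import GRing.Theory.
Local Open Scope ring_scope.

(** * Prime ideals divisible by a nonunit *)

(** No element of I is irreducible, as u splits off with a cofactor again in I,
hence again a nonunit; and primality puts an irreducible factor of y in I. *)
Lemma divisible_prime_not_atomic (D : idomainType) (I : D -> Prop) (u y : D) :
    (forall a b, I b -> I (a * b)) -> ~ I 1 ->
    (forall a b, I (a * b) -> I a \/ I b) ->
    (forall b, I b -> exists2 c, I c & b = u * c) ->
    u \isn't a GRing.unit -> I y -> y != 0 ->
  ~ atomic D.
Proof.
move=> idealI properI primeI divI uNU Iy y0 atD.
have nonunitI b : I b -> b \isn't a GRing.unit.
  by move=> Ib; apply/negP => bU; apply: properI; rewrite -(mulVr bU); exact: idealI.
have reducibleI b : I b -> ~ irreducible_elt b.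
  move=> /divI[c Ic ->] [_ _ /(_ u c erefl)[]]; first exact/negP.
  exact/negP/nonunitI.
have [s irr_s y_s] := atD y y0 (nonunitI y Iy).
move: Iy; rewrite {}y_s; elim: s irr_s => [|b s IHs] irr_s.
  by rewrite big_nil.
rewrite big_cons => /primeI[/reducibleI|]; first by apply; exact/irr_s/mem_head.
by apply: IHs => c sc; apply: irr_s; rewrite inE sc orbT.
Qed.

(** * Domains with a polynomial subring and a new unit *)

Section LocalizedPolynomials.
Variables (A D : idomainType) (phi : {rmorphism {poly A} -> D}) (u : A).
Hypotheses (phi_inj : injective phi) (phi_u : phi u%:P \is a GRing.unit).

(** That f is the fraction P / u^n, with the denominator cleared. *)
Definition represents (P : {poly A}) (n : nat) (f : D) : Prop :=
  phi u%:P ^+ n * f = phi P.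

(** The ring A + Y A[u^-1][Y] inside D. *)
Definition localized_poly : {pred D} :=
  fun f => `[< exists P n, represents P n f /\ exists q, P`_0 = u ^+ n * q >].

Lemma represents_mul P Q m n f g :
  represents P m f -> represents Q n g -> represents (P * Q) (m + n) (f * g).
Proof. by move=> Pf Qg; rewrite /represents rmorphM -Pf -Qg exprD mulrACA. Qed.

Lemma localized_poly_closed : subring_closed localized_poly.
Proof.
split.
- by apply/asboolP; exists 1, 0; split; [rewrite /represents mul1r rmorph1 |
    exists 1; rewrite mulr1 coefC].
- move=> f g /asboolP[P [m [Pf [p P0]]]] /asboolP[Q [n [Qg [q Q0]]]].
  apply/asboolP; exists (u%:P ^+ n * P - u%:P ^+ m * Q), (m + n)%N; split.
    rewrite /represents rmorphB !rmorphM !rmorphXn /= -Pf -Qg.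
    by rewrite mulrBr !mulrA -!exprD [(n + m)%N]addnC.
  exists (p - q); rewrite coefB -!polyC_exp !coefCM P0 Q0.
  by rewrite mulrBr !mulrA -!exprD [(n + m)%N]addnC.
move=> f g /asboolP[P [m [Pf [p P0]]]] /asboolP[Q [n [Qg [q Q0]]]].
apply/asboolP; exists (P * Q), (m + n)%N; split; first exact: represents_mul.
by exists (p * q); rewrite coef0M P0 Q0 exprD mulrACA.
Qed.

Lemma polynomial_in_localized (P : {poly A}) : phi P \in localized_poly.
Proof.
apply/asboolP; exists P, 0; split; first by rewrite /represents mul1r.
by exists P`_0; rewrite mul1r.
Qed.

(** The prime ideal here is Y A[u^-1][Y]: dividing one of its elements by u only
enlarges the denominator, which keeps it in the subring because the constant
term 0 is divisible by every power of u. *)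
Lemma poly_subring_not_hereditarily_atomic :
  u \isn't a GRing.unit -> ~ hereditarily_atomic D.
Proof.
move=> uNU hD.
have [U] := subring_subIdomain localized_poly_closed.
have u0 : u != 0.
  by apply: contraTneq phi_u => ->; rewrite rmorph0 unitr0.
have rep (a : U) : exists P n, represents P n (val a) /\ exists q, P`_0 = u ^+ n * q.
  by have /asboolP := valP a.
pose I (a : U) := exists2 P : {poly A}, P`_0 = 0 & exists n, represents P n (val a).
pose mk f (Sf : f \in localized_poly) : U := Sub f Sf.
have mkK f Sf : val (mk f Sf) = f by exact: SubK.
pose sub P := mk _ (polynomial_in_localized P).
have subK P : val (sub P) = phi P by exact: mkK.
(* The injectivity of phi turns identities between fractions into identities of
polynomials, which are then compared at Y = 0. *)
apply: (@divisible_prime_not_atomic U I (sub u%:P) (sub 'X)) (hD _ U).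
- move=> a b [P P0 [n Pb]]; have [Q [m [Qa _]]] := rep a.
  exists (Q * P); first by rewrite coef0M P0 mulr0.
  by exists (m + n)%N; rewrite rmorphM; exact: represents_mul.
- case=> P P0 [n]; rewrite /represents rmorph1 mulr1 -rmorphXn => /phi_inj P_E.
  by move/eqP: P0; rewrite -P_E -polyC_exp coefC /= expf_eq0 (negPf u0) andbF.
- move=> a b [T T0 [k Tab]].
  have [P [m [Pa _]]] := rep a; have [Q [n [Qb _]]] := rep b.
  have /phi_inj/(congr1 (fun W : {poly A} => W`_0)) :
      phi (u%:P ^+ k * (P * Q)) = phi (u%:P ^+ (m + n) * T).
    rewrite (rmorphM _ _ (P * Q)) (rmorphM _ _ T) !rmorphXn /= -Tab.
    by rewrite -(represents_mul Pa Qb) rmorphM mulrCA.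
  rewrite -!polyC_exp !coefCM coef0M T0 mulr0 => /eqP.
  rewrite !mulf_eq0 expf_eq0 (negPf u0) andbF /= => /orP[]/eqP W0.
    by left; exists P => //; exists m.
  by right; exists Q => //; exists n.
- move=> b [P P0 [n Pb]].
  have Pc : represents P n.+1 ((phi u%:P)^-1 * val b).
    by rewrite /represents exprSr -mulrA (mulVKr phi_u).
  have Sc : (phi u%:P)^-1 * val b \in localized_poly.
    by apply/asboolP; exists P, n.+1; split=> //; exists 0; rewrite mulr0.
  exists (mk _ Sc); first by exists P => //; exists n.+1; rewrite mkK.
  by apply: val_inj; rewrite rmorphM /= subK mkK (mulVKr phi_u).
- apply/negP => suU; have [P [n [Pv [q P0]]]] := rep (sub u%:P)^-1.
  move/(congr1 val): (mulrV suU); rewrite rmorphM rmorph1 /= subK => uv1.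
  have /phi_inj/(congr1 (fun W : {poly A} => W`_0)) :
      phi (u%:P ^+ n) = phi (u%:P * P).
    by rewrite rmorphM rmorphXn -Pv mulrCA uv1 mulr1.
  rewrite -polyC_exp coefC coefCM P0 /= mulrCA -[LHS]mulr1.
  move/(mulfI (expf_neq0 n u0)) => uq1; case/negP: uNU.
  by apply/unitrP; exists q; rewrite [q * u]mulrC -uq1.
- by exists 'X; [rewrite coefX | exists 0; rewrite /represents mul1r subK].
- by rewrite -(inj_eq val_inj) subK rmorph0 -(rmorph0 phi) (inj_eq phi_inj) polyX_eq0.
Qed.
End LocalizedPolynomials.

(** * Polynomials over R[x] evaluated at a power series *)

Section PolynomialsInFps.
Variable R : comNzRingType.

Definition fps_of_poly (p : {poly R}) : fps R := FPS (fun n => p`_n).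

Fact fps_of_poly_is_zmod_morphism : zmod_morphism fps_of_poly.
Proof. by move=> p q; apply/fpsP => n /=; rewrite coefB. Qed.
Fact fps_of_poly_is_monoid_morphism : monoid_morphism fps_of_poly.
Proof.
split; first by apply/fpsP => n /=; rewrite coef1.
by move=> p q; apply/fpsP => n /=; rewrite coefM.
Qed.
HB.instance Definition _ := GRing.isZmodMorphism.Build {poly R} (fps R)
  fps_of_poly fps_of_poly_is_zmod_morphism.
HB.instance Definition _ := GRing.isMonoidMorphism.Build {poly R} (fps R)
  fps_of_poly fps_of_poly_is_monoid_morphism.

Definition fps_eval (y : fps R) : {rmorphism {poly {poly R}} -> fps R} :=
  horner_eval y \o map_poly fps_of_poly.

(** Replacing y by a truncation modulo x^m makes the value a polynomial, without
changing it modulo x^m. *)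
Lemma coef_fps_eval (y : fps R) (P : {poly {poly R}}) m k : (k < m)%N ->
  fps_coef (fps_eval y P) k = (P.[fps_trunc m y])`_k.
Proof.
move=> lt_km; elim/poly_ind: P k lt_km => [|P p IHP] k lt_km.
  by rewrite rmorph0 horner0 coef0.
rewrite rmorphD rmorphM hornerMXaddC coefD coefM /=.
rewrite /horner_eval !map_polyX !map_polyC !hornerE /=; congr (_ + _).
apply: eq_bigr => i _; have lt_im : (i < m)%N.
  by apply: leq_ltn_trans lt_km; rewrite -ltnS.
by rewrite -IHP // coef_poly (leq_ltn_trans (leq_subr i k)).
Qed.
End PolynomialsInFps.

Lemma one_sub_X_unit_fps (R : idomainType) :
  fps_of_poly (1 - 'X : {poly R}) \is a GRing.unit.
Proof.
suff E : fps_of_poly (1 - 'X) * FPS (fun=> 1 : R) = 1 :> fps R.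
  apply/unitrP; exists (FPS (fun=> 1)); split; last exact: E.
  by rewrite mulrC; exact: E.
apply/fpsP; case=> [|n] /=; first by rewrite big_ord1 mulr1 coefB coef1 coefX /= subr0.
rewrite 2!big_ord_recl big1 => [|i _]; rewrite !(coefB, coef1, coefX) !mulr1 /=.
  by rewrite addr0 sub0r subr0 subrr.
by rewrite subr0.
Qed.

(** * A lacunary series transcendental over R[x] *)

Lemma size_horner_leq (R : nzRingType) (P : {poly {poly R}}) (s : {poly R}) m D :
    (forall i, size (P`_i)%R <= D)%N -> (size s <= m.+1)%N ->
  (size P.[s] <= D + m * size P)%N.
Proof.
move=> leD les; rewrite horner_coef; apply: (leq_trans (size_sum _ _ _)).
apply/bigmax_leqP => i _; apply: (leq_trans (size_polyMleq _ _)).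
rewrite -subn1 leq_subLR add1n -addnS; apply: leq_add; first exact: leD.
apply: (leq_trans (size_poly_exp_leq _ _)); rewrite ltnS.
by apply: leq_mul; [rewrite -subn1 leq_subLR | exact: ltnW].
Qed.

Section LacunarySeries.
Variable R : idomainType.

(** As 0! = 1!, the sum of x^(k!) over k would have 1 + 1 as a coefficient; testing
for exponents that are factorials keeps every coefficient 0 or 1. *)
Definition fact_series : fps R := FPS (fun n => (`[< exists k, n = k`! >])%:R).

(** The cutoff (N+1)!, and not N! + 1, makes the truncation agree with the
series across the whole gap after N!. *)
Definition fact_partial N : {poly R} := fps_trunc N.+1`! fact_series.

(** The truncations have distinct degrees N!, so they are distinct, and their
degree is far below their order of precision (N+1)!. *)
Lemma size_fact_partial N : (0 < N)%N -> size (fact_partial N) = N`!.+1.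
Proof.
move=> N_gt0; apply/eqP; rewrite eqn_leq; apply/andP; split.
  apply/leq_sizeP => j lt_Nj; rewrite coef_poly; case: ifP => //= lt_jN.
  case: asboolP => // -[k jk]; move: lt_Nj lt_jN; rewrite {}jk.
  case: (leqP k N) => [/leq_fact | /leq_fact]; lia.
rewrite ltnNge; apply/negP => /leq_sizeP/(_ _ (leqnn _))/eqP; apply/negP.
rewrite coef_poly /= factS ltn_Pmull ?fact_gt0 ?ltnS //.
by case: asboolP => [_|[]]; [exact: oner_neq0 | exists N].
Qed.

(** A polynomial that vanishes at the series also vanishes at its long
truncations, which are more numerous than its degree allows. *)
Lemma fact_series_transcendental : injective (fps_eval fact_series).
Proof.
apply: raddf_inj => P evP0; apply/eqP; apply: contraT => P0.
pose D := (\max_(i < size P) size (P`_i)%R)%N.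
have leD i : (size (P`_i)%R <= D)%N.
  case: (ltnP i (size P)) => [lt_iP | le_Pi].
    exact: (leq_bigmax (Ordinal lt_iP)).
  by rewrite nth_default // size_poly0.
(* The shift by D + size P makes N large enough for the bound
D + N! * size P on the size of the value at the N-th truncation to be at most
(N+1)!. *)
pose rs := [seq fact_partial (D + size P + i).+1 | i <- iota 0 (size P)].
suff : (size rs < size P)%N by rewrite size_map size_iota ltnn.
apply: max_poly_roots => //.
  apply/allP => _ /mapP[i _ ->]; set N := (_ + i).+1.
  apply/rootP/polyP => k; rewrite coef0; case: (ltnP k N.+1`!) => [lt_kN | le_Nk].
    by rewrite -(coef_fps_eval _ _ lt_kN) evP0.
  apply: nth_default; apply: leq_trans le_Nk.
  apply: (leq_trans (size_horner_leq leD (eq_leq (size_fact_partial _)))) => //.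
  have leN : (D + size P <= N.+1)%N by rewrite leqW // leqW // leq_addr.
  rewrite factS; apply: leq_trans (leq_mul leN (leqnn _)).
  by rewrite mulnDl [(size P * _)%N]mulnC leq_add2r leq_pmulr ?fact_gt0.
rewrite map_inj_uniq ?iota_uniq // => i j /(congr1 (fun p : {poly R} => size p)).
rewrite !size_fact_partial // => -[/(incn_inj_in leq_pfact) eq_ij].
by apply/(@addnI (D + size P)%N)/succn_inj/eq_ij.
Qed.
End LacunarySeries.

Theorem proposition5p11 (R : idomainType) : ~ hereditarily_atomic (fps R).
Proof.
apply: (@poly_subring_not_hereditarily_atomic _ _ (fps_eval (fact_series R))
  (1 - 'X)).
- exact: fact_series_transcendental.
- by rewrite /= /horner_eval map_polyC hornerC one_sub_X_unit_fps.
- by rewrite poly_unitE -opprB size_polyN size_XsubC.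
Qed.
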